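(* Let $n,m\in\mathbb{N}$ (positive integers). Then the following identities hold for all real $x$. (i) If both $n$ and $m$ are odd, then $$\cos^{n}x\,\sin^{m}x=\frac{1}{2^{n+m-1}}\sum_{k=0}^{\frac{n+m}{2}-1}(-1)^{\frac{m-1}{2}+k}\left(\sum_{r=0}^{k}(-1)^{r}\binom{n}{r}\binom{m}{k-r}\right)\sin\big((n+m-2k)x\big).$$ (ii) If $n$ is even and $m$ is odd, then $$\cos^{n}x\,\sin^{m}x=\frac{1}{2^{n+m-1}}\sum_{k=0}^{\frac{n+m-1}{2}}(-1)^{\frac{m-1}{2}+k}\left(\sum_{r=0}^{k}(-1)^{r}\binom{n}{r}\binom{m}{k-r}\right)\sin\big((n+m-2k)x\big).$$ (iii) If $n$ is odd and $m$ is even, then $$\cos^{n}x\,\sin^{m}x=\frac{1}{2^{n+m-1}}\sum_{k=0}^{\frac{n+m-1}{2}}(-1)^{\frac{m}{2}+k}\left(\sum_{r=0}^{k}(-1)^{r}\binom{n}{r}\binom{m}{k-r}\right)\cos\big((n+m-2k)x\big).$$ (iv) If both $n$ and $m$ are even, then $$\cos^{n}x\,\sin^{m}x=\frac{1}{2^{n+m-1}}\left(\sum_{k=0}^{\frac{n+m}{2}-1}(-1)^{\frac{m}{2}+k}\sum_{r=0}^{k}(-1)^{r}\binom{n}{r}\binom{m}{k-r}\cos\big((n+m-2k)x\big)+\frac{1}{2}(-1)^{\frac{2m+n}{2}}\sum_{r=0}^{\frac{n+m}{2}}(-1)^{r}\binom{n}{r}\binom{m}{\frac{n+m}{2}-r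}\right).$$
   Context: Convention: $\binom{a}{b}=0$ whenever $b>a$ or $b<0$. *)

(* Defs.v *)
From mathcomp Require Import all_boot all_order all_algebra.
From mathcomp Require Import reals trigo.

Set Implicit Arguments.
Unset Strict Implicit.
Unset Printing Implicit Defensive.

(* Main.v *)
Require Import Defs.
From mathcomp Require Import all_boot all_order all_algebra.
From mathcomp Require Import reals trigo.
From mathcomp Require Import ring zify.

(** By Euler's formulas,
    2^(n+m) cos^n x sin^m x = (-i)^m e^(i(n+m)x) (1 + q)^n (1 - q)^m
    with q = e^(-2ix). Expanding in powers of q and taking real parts gives a
    sum over 0 <= k <= n + m of b_k cos((n+m-2k)x - m pi/2), where b_k is the
    coefficient of X^k in (1 + X)^n (1 - X)^m (cos_sin_fourier). The proof stays
    over the reals: multiplication by 2 cos x or 2 sin x acts on such cosine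
    sums as multiplication of the polynomial by 1 + X or 1 - X, the latter with
    a phase shift of pi/2 (cos_poly_mul), so induction on n and m suffices.

    The polynomial (1 + X)^n (1 - X)^m equals (-1)^m times its reciprocal
    (reciprocal_sign_binom_poly), and this sign cancels against the phase, so
    the terms k and n + m - k are equal. Folding the sum leaves twice its first
    half, plus the zero-frequency term when n + m is even
    (cos_sin_half_fourier). Finally the phase m pi/2 turns the cosine into
    (-1)^(m/2) cos for even m and (-1)^((m-1)/2) sin for odd m; in particular
    the zero-frequency term vanishes when n and m are both odd. *)

Set Implicit Arguments.
Unset Strict Implicit.
Unset Printing Implicit Defensive.

Import Order.TTheory GRing.Theory Num.Theory.

Local Open Scope ring_scope.

(** * Coefficients of (1 + X)^n (1 - X)^m *)

Section Coefficients.
Variable R : comNzRingType.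
Implicit Types (p : {poly R}) (c s : R).

Definition sign_binom_poly (n m : nat) : {poly R} :=
  (1 + 'X) ^+ n * (1 - 'X) ^+ m.

Lemma coef_mul_1DcX p c k :
  (p * (1 + c *: 'X))`_k = p`_k + c * (if k == 0%N then 0 else p`_k.-1).
Proof. by rewrite mulrDr mulr1 -scalerAr coefD coefZ coefMX. Qed.

Lemma coef_1DcX_exp c n k : ((1 + c *: 'X) ^+ n)`_k = c ^+ k * 'C(n, k)%:R.
Proof.
elim: n k => [|n IHn] [|k].
- by rewrite expr0 coef1 bin0 mulr1.
- by rewrite expr0 coef1 mulr0.
- by rewrite exprSr coef_mul_1DcX IHn !bin0 mulr0 addr0.
- by rewrite exprSr coef_mul_1DcX !IHn /= binS natrD exprS; ring.
Qed.

Lemma sign_binom_polyE n m :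
  sign_binom_poly n m = (1 + 1 *: 'X) ^+ n * (1 + (-1) *: 'X) ^+ m.
Proof. by rewrite scale1r scaleN1r. Qed.

Lemma sign_binom_polySr n m :
  sign_binom_poly n m.+1 = sign_binom_poly n m * (1 + (-1) *: 'X).
Proof. by rewrite /sign_binom_poly scaleN1r exprSr mulrA. Qed.

Lemma sign_binom_polySl n m :
  sign_binom_poly n.+1 m = sign_binom_poly n m * (1 + 1 *: 'X).
Proof. by rewrite /sign_binom_poly scale1r exprSr mulrAC. Qed.

(** The inner sum of the identities is the coefficient of X^k in
    (1 - X)^n (1 + X)^m; substituting - X for X accounts for the sign. *)
Lemma coef_sign_binom_poly n m k :
  (sign_binom_poly n m)`_k =
  (-1) ^+ k * \sum_(0 <= r < k.+1) (-1) ^+ r * 'C(n, r)%:R * 'C(m, k - r)%:R.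
Proof.
rewrite sign_binom_polyE coefM big_mkord mulr_sumr.
apply: eq_bigr => r _; rewrite !coef_1DcX_exp expr1n mul1r.
have le_rk : (r <= k)%N by rewrite -ltnS.
by rewrite -(signr_odd R (k - r)) oddB // signr_addb !signr_odd; ring.
Qed.

(** Self-reciprocity up to the sign s with respect to the formal degree N,
    together with the degree bound that makes N meaningful. *)
Definition reciprocal N s p : Prop :=
  (forall k, (N < k)%N -> p`_k = 0) /\
  (forall k l, (k + l = N)%N -> p`_l = s * p`_k).

(** As c^2 = 1, the factor 1 + c X is c-reciprocal for the formal degree 1;
    in products formal degrees add and signs multiply. *)
Lemma reciprocal_mul N s p c :
  c * c = 1 -> reciprocal N s p -> reciprocal N.+1 (s * c) (p * (1 + c *: 'X)).
Proof.
move=> cc1 [deg_p rec_p]; split=> [k lt_Nk | k l eq_kl].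
  rewrite coef_mul_1DcX deg_p ?(ltnW lt_Nk) // add0r.
  by case: k lt_Nk => //= k lt_Nk; rewrite deg_p ?mulr0.
rewrite !coef_mul_1DcX.
case: k l eq_kl => [|k] [|l] //= eq_kl; rewrite ?mulr0 ?addr0.
- have -> : l = N by lia.
  by rewrite (deg_p N.+1) // (rec_p 0%N N) //; ring.
- have -> : k = N by lia.
  rewrite (deg_p N.+1) // (rec_p N 0%N) ?addn0 // add0r.
  by rewrite -[LHS]mul1r -cc1; ring.
- rewrite (rec_p k l.+1) ?(rec_p k.+1 l); try lia.
  by rewrite -[s * p`_k]mul1r -{1}cc1; ring.
Qed.

Lemma reciprocal_sign_binom_poly n m :
  reciprocal (n + m) ((-1) ^+ m) (sign_binom_poly n m).
Proof.
elim: m => [|m IHm].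
  elim: n => [|n IHn].
    split=> [k lt0k|k l]; rewrite /sign_binom_poly !expr0 mulr1 !coef1.
      by rewrite gtn_eqF.
    by case: k l => [|//] [|//] _; rewrite mul1r.
  rewrite sign_binom_polySl addSn -[X in reciprocal _ X]mulr1.
  exact: reciprocal_mul (mulr1 _) IHn.
rewrite sign_binom_polySr addnS exprSr.
by apply: reciprocal_mul IHm; rewrite mulrNN mulr1.
Qed.

End Coefficients.

(** * Sums over a symmetric range *)

(** The bound (N + 1)/2, rounded down, cuts off exactly the k with 2k < N; the
    fixed point of k |-> N - k survives when N is even. *)
Lemma sum_fold_sym (R : nzRingType) (N : nat) (f : nat -> R) :
  (forall k, (k <= N)%N -> f (N - k)%N = f k) ->
  \sum_(0 <= k < N.+1) f k =
  2 * \sum_(0 <= k < N.+1./2) f k + (if odd N then 0 else f N./2).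
Proof.
move=> symf; set h := (N.+1)./2.
have upper j : (j <= N.+1)%N ->
    \sum_(N.+1 - j <= k < N.+1) f k = \sum_(0 <= k < j) f k.
  elim: j => [_|j IHj ltjN]; first by rewrite subn0 !big_geq.
  rewrite [RHS]big_nat_recr //= -IHj ?(ltnW ltjN) // subSS addrC.
  rewrite big_ltn; last by lia.
  by rewrite symf // subSn.
rewrite (@big_cat_nat _ _ _ h) //=; last by rewrite /h; lia.
rewrite (@big_cat_nat _ _ _ (N.+1 - h) h) /=; [|rewrite /h; lia..].
rewrite upper; last by rewrite /h; lia.
rewrite [X in _ + X]addrC addrA mulr2n mulrDl mul1r; congr (_ + _).
have [oddN|evenN] := boolP (odd N).
  by rewrite big_geq // /h; lia.
have -> : h = N./2 by rewrite /h; lia.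
have -> : (N.+1 - N./2 = (N./2).+1)%N by lia.
by rewrite big_nat1.
Qed.

(** * Fourier expansion *)

Section Fourier.
Variable R : realType.
Implicit Types (p : {poly R}) (x t a c : R).

(** For p of degree at most N this is the real part of
    exp(i (N x - a)) p(exp(-2 i x)). *)
Definition cos_poly p N x a : R :=
  \sum_(0 <= k < N.+1) p`_k * cos ((N%:R - (2 * k)%:R) * x - a).

(** Multiplying p by 1 + c X multiplies the underlying complex exponential
    sum by exp(i x) + c exp(- i x), that is, spreads each frequency to its two
    neighbours. *)
Lemma cos_poly_mul p N c x a :
  (forall k, (N < k)%N -> p`_k = 0) ->
  cos_poly (p * (1 + c *: 'X)) N.+1 x a =
  \sum_(0 <= k < N.+1)
    p`_k * (cos ((N%:R - (2 * k)%:R) * x - a + x) +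
            c * cos ((N%:R - (2 * k)%:R) * x - a - x)).
Proof.
move=> deg_p; rewrite /cos_poly.
under eq_bigr do rewrite coef_mul_1DcX mulrDl.
rewrite big_split /= big_nat_recr //= deg_p // mul0r addr0.
rewrite [X in _ + X]big_nat_recl //= mulr0 mul0r add0r -big_split /=.
apply: eq_bigr => k _; rewrite mulrDr; congr (_ * cos _ + _).
  by rewrite -natr1; ring.
rewrite -mulrA mulrCA; congr (_ * (_ * cos _)).
by rewrite !natrM -!natr1; ring.
Qed.

Lemma cosD_cosB t x : cos (t + x) + 1 * cos (t - x) = 2 * cos x * cos t.
Proof. by rewrite cosD cosB; ring. Qed.

(** The factor - i in sin x = - i (exp(i x) - exp(- i x)) / 2 is a shift of
    the phase by a right angle. *)
Lemma cosD_cosB_pihalf t x :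
  cos (t - pi / 2 + x) + -1 * cos (t - pi / 2 - x) = 2 * sin x * cos t.
Proof. by rewrite [cos (_ + x)]cosD [cos (_ - x)]cosB cosBpihalf sinBpihalf; ring. Qed.

(** Euler's formulas give 2^(n+m) cos^n x sin^m x =
    (-i)^m (e^(ix) + e^(-ix))^n (e^(ix) - e^(-ix))^m; expanding in powers of
    e^(-2ix) and reading off the real part yields the right-hand side. *)
Lemma cos_sin_fourier n m x :
  2 ^+ (n + m) * (cos x ^+ n * sin x ^+ m) =
  cos_poly (sign_binom_poly R n m) (n + m) x (m%:R * (pi / 2)).
Proof.
(* The induction step needs every phase, not only m right angles. *)
suff gen b : 2 ^+ (n + m) * (cos x ^+ n * sin x ^+ m) * cos b =
    cos_poly (sign_binom_poly R n m) (n + m) x (m%:R * (pi / 2) - b).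
  by have := gen 0; rewrite cos0 mulr1 subr0.
have deg n' m' := (reciprocal_sign_binom_poly R n' m').1.
elim: m b => [|m IHm] b.
  elim: n b => [|n IHn] b.
    by rewrite /cos_poly big_nat1 /sign_binom_poly addn0 !expr0 !mulr1 coef1 !mul1r
               muln0 subr0 !mul0r !sub0r opprK.
  rewrite sign_binom_polySl addSn cos_poly_mul; last exact: deg.
  under eq_bigr do rewrite cosD_cosB mulrCA.
  rewrite -mulr_sumr; have := IHn b; rewrite /cos_poly => <-.
  by rewrite !exprS; ring.
rewrite sign_binom_polySr addnS cos_poly_mul; last exact: deg.
have phase k : ((n + m)%:R - (2 * k)%:R) * x - (m.+1%:R * (pi / 2) - b) =
    ((n + m)%:R - (2 * k)%:R) * x - (m%:R * (pi / 2) - b) - pi / 2 :> R.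
  by rewrite -natr1; ring.
under eq_bigr do rewrite phase cosD_cosB_pihalf mulrCA.
rewrite -mulr_sumr; have := IHm b; rewrite /cos_poly => <-.
by rewrite !exprS; ring.
Qed.

Lemma cosB_nat_pi t m : cos (t - m%:R * pi) = (-1) ^+ m * cos t.
Proof.
elim: m t => [|m IHm] t; first by rewrite mul0r subr0 mul1r.
have -> : t - m.+1%:R * pi = (t - pi) - m%:R * pi by rewrite -natr1; ring.
by rewrite IHm -{2}(subrK pi t) cosDpi exprSr; ring.
Qed.

Lemma cosB_pihalf_even t m :
  ~~ odd m -> cos (t - m%:R * (pi / 2)) = (-1) ^+ m./2 * cos t.
Proof.
move=> em; rewrite -cosB_nat_pi; congr (cos (_ - _)).
by rewrite -{1}(even_halfK em) -mul2n natrM; field.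
Qed.

Lemma cosB_pihalf_odd t m :
  odd m -> cos (t - m%:R * (pi / 2)) = (-1) ^+ (m - 1)./2 * sin t.
Proof.
case: m => // m /= em; rewrite subn1 /=.
rewrite -cosBpihalf -cosB_pihalf_even //; congr cos.
by rewrite -natr1; ring.
Qed.

(** The frequencies N - 2k and -(N - 2k) contribute equally: the sign (-1)^m
    by which the coefficients change is that of cos under reflection about
    m right angles. Only half of the frequencies remain. *)
Lemma cos_sin_half_fourier n m x :
  let N := (n + m)%N in
  let f k := (sign_binom_poly R n m)`_k *
             cos ((N%:R - (2 * k)%:R) * x - m%:R * (pi / 2)) in
  2 ^+ N * (cos x ^+ n * sin x ^+ m) =
  2 * \sum_(0 <= k < N.+1./2) f k + (if odd N then 0 else f N./2).
Proof.
move=> N f; rewrite cos_sin_fourier -/N -sum_fold_sym // => k le_kN.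
have [_ rec_p] := reciprocal_sign_binom_poly R n m.
rewrite /f (rec_p k (N - k)%N) ?subnKC //.
rewrite mulrAC [RHS]mulrC; congr (_ * _).
rewrite -[X in _ * X]cosN -cosB_nat_pi; congr cos.
by rewrite !natrM natrB //; field.
Qed.

End Fourier.

(** * The four parity cases *)

Theorem theorem1p5 (R : realType) (n m : nat) (hn : (0 < n)%N) (hm : (0 < m)%N) :
  [/\ (odd n -> odd m -> forall x : R,
        cos x ^+ n * sin x ^+ m =
        1 / 2 ^+ (n + m - 1) *
        \sum_(0 <= k < (n + m)./2)
          (-1) ^+ ((m - 1)./2 + k) *
          (\sum_(0 <= r < k.+1) (-1) ^+ r * 'C(n, r)%:R * 'C(m, k - r)%:R) *
          sin (((n + m)%:R - (2 * k)%:R) * x)),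
      (~~ odd n -> odd m -> forall x : R,
        cos x ^+ n * sin x ^+ m =
        1 / 2 ^+ (n + m - 1) *
        \sum_(0 <= k < ((n + m - 1)./2).+1)
          (-1) ^+ ((m - 1)./2 + k) *
          (\sum_(0 <= r < k.+1) (-1) ^+ r * 'C(n, r)%:R * 'C(m, k - r)%:R) *
          sin (((n + m)%:R - (2 * k)%:R) * x)),
      (odd n -> ~~ odd m -> forall x : R,
        cos x ^+ n * sin x ^+ m =
        1 / 2 ^+ (n + m - 1) *
        \sum_(0 <= k < ((n + m - 1)./2).+1)
          (-1) ^+ (m./2 + k) *
          (\sum_(0 <= r < k.+1) (-1) ^+ r * 'C(n, r)%:R * 'C(m, k - r)%:R) *
          cos (((n + m)%:R - (2 * k)%:R) * x)) &
      (~~ odd n -> ~~ odd m -> forall x : R,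
        cos x ^+ n * sin x ^+ m =
        1 / 2 ^+ (n + m - 1) *
        (\sum_(0 <= k < (n + m)./2)
           (-1) ^+ (m./2 + k) *
           (\sum_(0 <= r < k.+1) (-1) ^+ r * 'C(n, r)%:R * 'C(m, k - r)%:R) *
           cos (((n + m)%:R - (2 * k)%:R) * x)
         + 1 / 2 * (-1) ^+ ((2 * m + n)./2) *
           \sum_(0 <= r < ((n + m)./2).+1)
             (-1) ^+ r * 'C(n, r)%:R * 'C(m, (n + m)./2 - r)%:R))].
Proof.
have pow2_neq0 : 2 ^+ (n + m - 1) != 0 :> R by rewrite expf_neq0 ?pnatr_eq0.
have divide (y s : R) :
    2 ^+ (n + m) * y = 2 * s -> y = 1 / 2 ^+ (n + m - 1) * s.
  have -> : 2 ^+ (n + m) = 2 * 2 ^+ (n + m - 1) :> R.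
    by rewrite -exprS; congr (_ ^+ _); lia.
  rewrite -mulrA => /mulfI <-; last by rewrite pnatr_eq0.
  by rewrite mul1r mulKf.
(* With n + m even, the frequency left unpaired is zero. *)
have middle (x : R) : ~~ odd (n + m) ->
    ((n + m)%:R - (2 * (n + m)./2)%:R) * x = 0 :> R.
  by move=> even_nm; rewrite mul2n even_halfK // subrr mul0r.
have half_even : ~~ odd (n + m) -> (n + m).+1./2 = (n + m)./2 by lia.
have half_odd : odd (n + m) -> (n + m).+1./2 = ((n + m - 1)./2).+1 by lia.
have sgn (j k : nat) (y z : R) :
    (-1) ^+ k * y * ((-1) ^+ j * z) = (-1) ^+ (j + k) * y * z.
  by rewrite exprD; ring.
split=> par_n par_m x; apply: divide; rewrite cos_sin_half_fourier.
- have even_nm : ~~ odd (n + m) by rewrite oddD par_n par_m.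
  rewrite (negbTE even_nm) middle // cosB_pihalf_odd // sin0 !mulr0 addr0.
  rewrite half_even //; congr (2 * _); apply: eq_bigr => k _.
  by rewrite cosB_pihalf_odd // coef_sign_binom_poly sgn.
- have odd_nm : odd (n + m) by rewrite oddD (negbTE par_n) par_m.
  rewrite odd_nm addr0 half_odd //; congr (2 * _); apply: eq_bigr => k _.
  by rewrite cosB_pihalf_odd // coef_sign_binom_poly sgn.
- have odd_nm : odd (n + m) by rewrite oddD par_n (negbTE par_m).
  rewrite odd_nm addr0 half_odd //; congr (2 * _); apply: eq_bigr => k _.
  by rewrite cosB_pihalf_even // coef_sign_binom_poly sgn.
- have even_nm : ~~ odd (n + m) by rewrite oddD (negbTE par_n) (negbTE par_m).
  rewrite (negbTE even_nm) middle // cosB_pihalf_even // cos0 half_even //.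
  rewrite mulrDr; congr (2 * _ + _).
    by apply: eq_bigr => k _; rewrite cosB_pihalf_even // coef_sign_binom_poly sgn.
  rewrite coef_sign_binom_poly sgn mulr1.
  have -> : (m./2 + (n + m)./2 = (2 * m + n)./2)%N by lia.
  by field.
Qed.
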